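(* For every metric space $(X,d)$ and every open set $G\subset X$ with non-empty boundary $\partial G$, the Gehring-Osgood metric $$\widetilde{j}_G(x,y)=\frac12\log\left[\left(1+\frac{d(x,y)}{\delta(x)}\right)\left(1+\frac{d(x,y)}{\delta(y)}\right)\right],\qquad x,y\in G,$$ where $\delta(x)=\mathrm{dist}(x,\partial G)$, is Gromov hyperbolic on $G$ with a Gromov constant at most $\frac14\log 24$.
   Context: $\log$ is the natural logarithm. For a nonempty $A\subset X$, $\mathrm{dist}(x,A)=\inf\{d(x,a):a\in A\}$. The function $\widetilde{j}_G$ is a metric on $G$. A metric $\rho$ on a set $S$ is Gromov hyperbolic with Gromov constant $\kappa\ge 0$ if for all $x,y,z,w\in S$ $$\rho(x,z)+\rho(y,w)\le\max\{\rho(x,w)+\rho(y,z),\ \rho(x,y)+\rho(z,w)\}+2\kappa .$$ *)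

(* Defs.v *)
From HB Require Import structures.
From mathcomp Require Import all_boot all_order all_algebra.
From mathcomp Require Import all_classical all_reals all_analysis.

Set Implicit Arguments.
Unset Strict Implicit.
Unset Printing Implicit Defensive.

Import Order.TTheory GRing.Theory Num.Theory.

Local Open Scope classical_set_scope.
Local Open Scope ring_scope.

Definition boundary (T : topologicalType) (A : set T) : set T :=
  closure A `\` interior A.

(* [inf] is real-valued and takes the junk value 0 on the empty set, so
   [dist x A] is meaningful for nonempty [A] only. *)
Definition dist (R : realType) (X : metricType R) (x : X) (A : set X) : R :=
  inf [set mdist x a | a in A].

Definition gehring_osgood (R : realType) (X : metricType R) (G : set X)
    (x y : X) : R :=
  let delta z := dist z (boundary G) in
  2^-1 * ln ((1 + mdist x y / delta x) * (1 + mdist x y / delta y)).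

(* [rho] is a total function on [T], constrained on [S] only. *)
Definition metric_on (R : realType) (T : Type) (S : set T)
    (rho : T -> T -> R) : Prop :=
  [/\ forall x y, S x -> S y -> 0 <= rho x y,
      forall x y, S x -> S y -> (rho x y = 0 <-> x = y),
      forall x y, S x -> S y -> rho x y = rho y x
    & forall x y z, S x -> S y -> S z -> rho x z <= rho x y + rho y z].

Definition gromov_hyperbolic_on (R : realType) (T : Type) (S : set T)
    (rho : T -> T -> R) (kappa : R) : Prop :=
  [/\ metric_on S rho, 0 <= kappa
    & forall x y z w, S x -> S y -> S z -> S w ->
        rho x z + rho y w <=
          Num.max (rho x w + rho y z) (rho x y + rho z w) + 2 * kappa].

(* Main.v *)
Require Import Defs.
From HB Require Import structures.
From mathcomp Require Import all_boot all_order all_algebra.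
From mathcomp Require Import all_classical all_reals all_analysis.
From mathcomp Require Import ring lra.

Set Implicit Arguments.
Unset Strict Implicit.
Unset Printing Implicit Defensive.

Import Order.TTheory GRing.Theory Num.Theory.

Local Open Scope classical_set_scope.
Local Open Scope ring_scope.

(** Write [d] for the distance of [X], [delta] for the distance to the boundary
    and [P x y] for the product [(delta x + d x y) * (delta y + d x y)].  The
    Gehring-Osgood metric is
    [(ln (P x y) - ln (delta x) - ln (delta y)) / 2], and the terms in [delta]
    contribute equally to the three pairings of four points.  The four-point
    condition is therefore a condition on [ln P] alone.

    Now [ln P] is almost an ultrametric: [P x z] is at most [9 / 2] times the
    larger of [P x y] and [P y z] ([quasi_ultrametric_product]).  This is an
    inequality between real numbers that uses only the triangle inequality for
    [d] and the fact that [delta] is 1-Lipschitz.  The four-point condition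
    holds for ultrametrics without any error term, and an error [c] in the
    ultrametric inequality costs at most [2 * c]
    ([four_point_of_quasi_ultrametric]).  Hence [ln (9 / 2) / 2] is a Gromov
    constant, and it is at most [ln 24 / 4] since [(9 / 2) ^+ 2 = 81 / 4] is
    less than [24].

    The triangle inequality of the metric also reduces to the Lipschitz property
    of [delta] ([triangle_product]). *)

(** * Inequalities between real numbers *)

(** The six numbers are the mutual distances of four points, [e] and [g] being
    the diagonals of the quadrilateral with successive sides [p], [q], [r] and
    [s].  Each end of a shortest side lies on one diagonal, and the ultrametric
    inequality in the triangle formed by that side and that diagonal bounds the
    diagonal by the third side of the triangle.  The two sides found in this way
    are opposite to each other. *)
Lemma four_point_of_quasi_ultrametric (F : realFieldType) (c p q r s e g : F) :
  e <= Num.max p q + c -> e <= Num.max r s + c ->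
  g <= Num.max q r + c -> g <= Num.max s p + c ->
  e + g <= Num.max (s + q) (p + r) + 2 * c.
Proof.
case: (leP p q); case: (leP r s); case: (leP q r); case: (leP s p);
  case: (leP (s + q) (p + r)); lra.
Qed.

(** Both [a] and [s] are lower bounds for [c + s].  The constant [9 / 8] is the
    best one: with the bound [Num.max a s] for [c + s] there is equality when
    [a = s]. *)
Lemma sqr_half_le_product (F : realFieldType) (a c s : F) :
  0 <= a -> 0 <= c -> 0 <= s -> a <= c + s ->
  (a / 2 + s) ^+ 2 <= 9 / 8 * ((a + s) * (c + s)).
Proof.
move=> a0 c0 s0 acs; case: (leP a s) => [a_le_s|/ltW s_le_a].
- have le_cs : (a + s) * s <= (a + s) * (c + s) by rewrite ler_wpM2l //; lra.
  have : 0 <= (s - a) * (s + 2 * a) by rewrite mulr_ge0 //; lra.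
  by nra.
- have le_cs : (a + s) * a <= (a + s) * (c + s) by rewrite ler_wpM2l //; lra.
  have : 0 <= (a - s) * (7 * a + 8 * s) by rewrite mulr_ge0 //; lra.
  by nra.
Qed.

(** Here [a], [c] and [b] are the distances to the boundary from three points
    [x], [y] and [z], and [s], [t] and [u] are the distances from [x] to [y],
    from [y] to [z] and from [x] to [z].  By the inequality of arithmetic and
    geometric means, the left-hand side is at most the square of
    [(a / 2 + s) + (b / 2 + t)], and each of these two terms is controlled by
    one of the products on the right. *)
Lemma quasi_ultrametric_product (F : realFieldType) (a b c s t u : F) :
  0 <= a -> 0 <= b -> 0 <= c -> 0 <= s -> 0 <= t -> 0 <= u ->
  u <= s + t -> a <= c + s -> b <= c + t ->
  (a + u) * (b + u) <=
    9 / 2 * Num.max ((a + s) * (c + s)) ((c + t) * (b + t)).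
Proof.
move=> a0 b0 c0 s0 t0 u0 ust acs bct.
have le_s := sqr_half_le_product a0 c0 s0 acs.
have le_t := sqr_half_le_product b0 c0 t0 bct.
have le_prod : (a + u) * (b + u) <= (a + (s + t)) * (b + (s + t)).
  by apply: ler_pM; lra.
have le_sqr : (a + (s + t)) * (b + (s + t)) <=
    2 * (a / 2 + s) ^+ 2 + 2 * (b / 2 + t) ^+ 2.
  have := sqr_ge0 ((a / 2 + s) - (b / 2 + t)); have := sqr_ge0 (a - b).
  by nra.
rewrite (mulrC (c + t)).
by case: (leP ((a + s) * (c + s)) ((b + t) * (c + t))) => ?; lra.
Qed.

(** The notation is that of [quasi_ultrametric_product].  The product splits
    into [(a + u) * c <= (a + s) * (c + t)] and its mirror image.  The first of
    them follows from [u <= s + t] and the Lipschitz bound [c <= a + s]. *)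
Lemma triangle_product (F : realFieldType) (a b c s t u : F) :
  0 <= a -> 0 <= b -> 0 <= c -> 0 <= s -> 0 <= t -> 0 <= u ->
  u <= s + t -> c <= a + s -> c <= b + t ->
  (a + u) * (b + u) * (c * c) <=
    (a + s) * (c + s) * ((c + t) * (b + t)).
Proof.
move=> a0 b0 c0 s0 t0 u0 ust cas cbt.
have le_a : (a + u) * c <= (a + s) * (c + t) by nra.
have le_b : (b + u) * c <= (b + t) * (c + s) by nra.
have -> : (a + u) * (b + u) * (c * c) = ((a + u) * c) * ((b + u) * c) by ring.
have -> : (a + s) * (c + s) * ((c + t) * (b + t)) =
  ((a + s) * (c + t)) * ((b + t) * (c + s)) by ring.
by apply: ler_pM => //; apply: mulr_ge0 => //; apply: addr_ge0.
Qed.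

(** * The distance to the boundary *)

Lemma dist_le_mdist (R : realType) (X : metricType R) (A : set X) (x a : X) :
  A a -> dist x A <= mdist x a.
Proof.
move=> Aa; apply: ge_inf; last by exists a.
by exists 0 => _ [b _ <-]; exact: mdist_ge0.
Qed.

Lemma dist_lipschitz (R : realType) (X : metricType R) (A : set X) (x y : X) :
  A !=set0 -> dist x A <= dist y A + mdist x y.
Proof.
move=> [a0 Aa0]; rewrite -lerBlDr; apply: lb_le_inf.
  by exists (mdist y a0), a0.
move=> _ [a Aa <-]; rewrite lerBlDr.
rewrite (le_trans (dist_le_mdist x Aa)) // addrC.
exact: metric_triangle.
Qed.

(** A ball around [x] inside [G] consists of interior points of [G]. *)
Lemma dist_boundary_gt0 (R : realType) (X : metricType R) (G : set X) (x : X) :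
  open G -> boundary G !=set0 -> G x -> 0 < dist x (boundary G).
Proof.
move=> openG [a0 Ba0] Gx.
have /nbhs_ballP[e /= e0 xeG] : nbhs x G by exact: open_nbhs_nbhs.
apply: (lt_le_trans e0); apply: lb_le_inf; first by exists (mdist x a0), a0.
move=> _ [a [_ NGa] <-]; rewrite leNgt; apply/negP => xa; apply: NGa.
have -> : interior G = G by move: openG; rewrite interior_id.
by apply: xeG; rewrite ballEmdist.
Qed.

(** * The Gehring-Osgood metric *)

Definition boundary_product (R : realType) (X : metricType R) (G : set X)
    (x y : X) : R :=
  (dist x (boundary G) + mdist x y) * (dist y (boundary G) + mdist x y).

Lemma boundary_productC (R : realType) (X : metricType R) (G : set X) x y :
  boundary_product G x y = boundary_product G y x.
Proof. by rewrite /boundary_product metric_sym mulrC. Qed.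

Lemma boundary_product_gt0 (R : realType) (X : metricType R) (G : set X) x y :
  open G -> boundary G !=set0 -> G x -> G y -> 0 < boundary_product G x y.
Proof.
move=> openG bdG Gx Gy.
by rewrite mulr_gt0 // ltr_wpDr ?mdist_ge0 ?dist_boundary_gt0.
Qed.

Lemma gehring_osgoodE (R : realType) (X : metricType R) (G : set X) x y :
  open G -> boundary G !=set0 -> G x -> G y ->
  gehring_osgood G x y =
    2^-1 * (ln (boundary_product G x y)
      - (ln (dist x (boundary G)) + ln (dist y (boundary G)))).
Proof.
move=> openG bdG Gx Gy; rewrite /gehring_osgood.
have dx := dist_boundary_gt0 openG bdG Gx.
have dy := dist_boundary_gt0 openG bdG Gy.
have P0 := boundary_product_gt0 openG bdG Gx Gy.
rewrite -lnM ?posrE // -ln_div ?posrE ?(mulr_gt0 dx dy) //.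
congr (_ * ln _); rewrite /boundary_product.
by field; rewrite !gt_eqF.
Qed.

Lemma gehring_osgood_metric (R : realType) (X : metricType R) (G : set X) :
  open G -> boundary G !=set0 -> metric_on G (gehring_osgood G).
Proof.
move=> openG bdG.
have d0 x : G x -> 0 < dist x (boundary G) by exact: dist_boundary_gt0.
have ratio_ge0 x y : G x -> 0 <= mdist x y / dist x (boundary G).
  by move=> Gx; rewrite divr_ge0 ?mdist_ge0 ?ltW ?d0.
have arg_ge1 x y : G x -> G y -> 1 <= (1 + mdist x y / dist x (boundary G)) *
    (1 + mdist x y / dist y (boundary G)).
  move=> Gx Gy; rewrite mulr_ege1 // lerDl ?ratio_ge0 //.
  by rewrite metric_sym ratio_ge0.
split.
- by move=> x y Gx Gy; rewrite mulr_ge0 ?invr_ge0 // ln_ge0 ?arg_ge1.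
- move=> x y Gx Gy; split=> [|->]; last first.
    by rewrite /gehring_osgood mdistxx !mul0r addr0 mulr1 ln1 mulr0.
  move/eqP; rewrite mulf_eq0 invr_eq0 pnatr_eq0 /=.
  rewrite ln_eq0; last exact: lt_le_trans ltr01 (arg_ge1 _ _ Gx Gy).
  (* Both factors are at least 1 and their product is 1, so each of them is 1. *)
  move=> /eqP prod1; apply: mdist_positivity; apply/eqP.
  have r1 := ratio_ge0 x y Gx; have r2 := ratio_ge0 y x Gy.
  rewrite [mdist y x]metric_sym in r2.
  have : mdist x y / dist x (boundary G) = 0 by nra.
  by move/eqP; rewrite mulf_eq0 invr_eq0 (gt_eqF (d0 _ Gx)) orbF.
- move=> x y Gx Gy.
  by rewrite /gehring_osgood metric_sym [X in ln X]mulrC.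
- move=> x y z Gx Gy Gz; rewrite !gehring_osgoodE //.
  have Pxz := boundary_product_gt0 openG bdG Gx Gz.
  have Pxy := boundary_product_gt0 openG bdG Gx Gy.
  have Pyz := boundary_product_gt0 openG bdG Gy Gz.
  suff : ln (boundary_product G x z) +
      (ln (dist y (boundary G)) + ln (dist y (boundary G))) <=
      ln (boundary_product G x y) + ln (boundary_product G y z) by lra.
  have dyy := mulr_gt0 (d0 y Gy) (d0 y Gy).
  rewrite -(lnM (d0 y Gy) (d0 y Gy)) -(lnM Pxz dyy) -(lnM Pxy Pyz).
  rewrite (ler_ln (mulr_gt0 Pxz dyy) (mulr_gt0 Pxy Pyz)).
  have dW v : G v -> 0 <= dist v (boundary G) by move=> /d0/ltW.
  apply: triangle_product; rewrite ?mdist_ge0 ?metric_triangle ?dW //.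
    by rewrite metric_sym dist_lipschitz.
  exact: dist_lipschitz.
Qed.

Lemma ln_boundary_product_quasi_ultrametric (R : realType) (X : metricType R)
    (G : set X) x y z : open G -> boundary G !=set0 -> G x -> G y -> G z ->
  ln (boundary_product G x z) <=
    Num.max (ln (boundary_product G x y)) (ln (boundary_product G y z))
      + ln (9 / 2).
Proof.
move=> openG bdG Gx Gy Gz.
have d0 v : G v -> 0 <= dist v (boundary G).
  by move=> Gv; rewrite ltW ?dist_boundary_gt0.
have Pxz := boundary_product_gt0 openG bdG Gx Gz.
have Pxy := boundary_product_gt0 openG bdG Gx Gy.
have Pyz := boundary_product_gt0 openG bdG Gy Gz.
have : boundary_product G x z <=
    9 / 2 * Num.max (boundary_product G x y) (boundary_product G y z).
  apply: quasi_ultrametric_product; rewrite ?mdist_ge0 ?metric_triangle ?d0 //.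
    exact: dist_lipschitz.
  by rewrite metric_sym dist_lipschitz.
have c0 : 0 < 9 / 2 :> R by lra.
have max0 : 0 < Num.max (boundary_product G x y) (boundary_product G y z).
  by rewrite lt_max Pxy.
rewrite addrC -(ler_ln Pxz (mulr_gt0 c0 max0)) (lnM c0 max0) => le_ln.
apply: (le_trans le_ln); rewrite lerD2l.
by case: (leP (boundary_product G x y)) => _; rewrite le_max lexx ?orbT.
Qed.

Theorem corollary5 (R : realType) (X : metricType R) (G : set X)
    (openG : open G) (bdG : boundary G !=set0) :
  exists2 kappa : R, kappa <= 4^-1 * ln 24
    & gromov_hyperbolic_on G (gehring_osgood G) kappa.
Proof.
have c0 : 0 < 9 / 2 :> R by lra.
exists (2^-1 * ln (9 / 2)).
  suff : ln (9 / 2) + ln (9 / 2) <= ln 24 :> R by lra.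
  by rewrite -lnM ?posrE // ler_ln ?posrE ?mulr_gt0 //; lra.
split; first exact: gehring_osgood_metric.
  by rewrite mulr_ge0 ?invr_ge0 // ln_ge0; lra.
move=> x y z w Gx Gy Gz Gw; rewrite !gehring_osgoodE //.
have qu a b c : G a -> G b -> G c -> _ :=
  @ln_boundary_product_quasi_ultrametric R X G a b c openG bdG.
have xyz := qu x y z Gx Gy Gz.
have zwx := qu z w x Gz Gw Gx.
have yzw := qu y z w Gy Gz Gw.
have wxy := qu w x y Gw Gx Gy.
rewrite (boundary_productC G z x) (boundary_productC G w x) in zwx.
rewrite (boundary_productC G w y) (boundary_productC G w x) in wxy.
have := four_point_of_quasi_ultrametric xyz zwx yzw wxy.
rewrite {1}/Num.max; case: ifP => _ le4.
  by rewrite -lerBlDr le_max; apply/orP; right; lra.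
by rewrite -lerBlDr le_max; apply/orP; left; lra.
Qed.
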